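(* Let $a,c,k\in\mathbb{R}\setminus\{0\}$ and $q\in(0,1)$, and consider the fractional system with control at $e_0=(0,0,0)$ $$\begin{cases} D_t^q x^1(t) = -x^2(t)x^3(t)+a\,x^1(t),\\ D_t^q x^2(t) = x^1(t)x^3(t)+k\,x^2(t),\\ D_t^q x^3(t) = \tfrac13 x^1(t)x^2(t)-c\,x^3(t).\end{cases}$$ 1. Suppose $k<0$. (i) If $a<0$ and $c>0$, then $e_0$ is asymptotically stable. (ii) If $ac>0$, or if $a>0$ and $c<0$, then $e_0$ is unstable. 2. Suppose $k>0$. Then for all $a,c\in\mathbb{R}\setminus\{0\}$, $e_0$ is unstable.
   Context: Superscripts on $x$ are coordinate indices. $D_t^q$ is the Caputo derivative of order $q\in(0,1)$, $D_t^q f(t)=\frac{1}{\Gamma(1-q)}\int_0^t (t-s)^{-q}f'(s)\,ds$. For an equilibrium $x_e=(x_e^1,x_e^2,x_e^3)$ of the special fractional-order Chen-Lee system $D_t^qx^1=-x^2x^3+ax^1,\ D_t^qx^2=x^1x^3,\ D_t^qx^3=\frac13x^1x^2-cx^3$, the special fractional Chen-Lee system with control at $x_e$ is obtained by adding the term $k(x^2-x_e^2)$ to the second equation; $k$ is the control parameter. Here $x_e=e_0$. For a fractional system $D_t^q x=f(x)$ in $\mathbb{R}^n$ with $f$ smooth and $q\in(0,1)$, an equilibrium state is a point $x_e$ with $f(x_e)=0$. Let $\lambda_1,\dots,\lambda_n$ be the eigenvalues of the Jacobian matrix $J(x_e)=(\partial f_i/\partial x^j)(x_e)$, with $\arg\in(-\pi,\pi]$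 and the convention $\arg(0)=0$. Stability terms are understood through Matignon's test: $x_e$ is asymptotically stable if and only if $|\arg(\lambda_i)|>\frac{q\pi}{2}$ for all $i$; $x_e$ is (locally) stable if and only if it is asymptotically stable or $|\arg(\lambda_i)|\ge\frac{q\pi}{2}$ for all $i$ and the eigenvalues with $|\arg(\lambda_j)|=\frac{q\pi}{2}$ have geometric multiplicity one; $x_e$ is unstable if it is not stable in this sense, in particular if $|\arg(\lambda_i)|<\frac{q\pi}{2}$ for some $i$. *)

(* Defs.v *)
(* MathComp-Analysis; complex numbers from mathcomp-real-closed. *)
From HB Require Import structures.
From mathcomp Require Import all_boot all_order all_algebra.
From mathcomp Require Import all_classical all_reals all_analysis.
From mathcomp Require Import complex.
Set Implicit Arguments.
Unset Strict Implicit.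
Unset Printing Implicit Defensive.
Import Order.TTheory GRing.Theory Num.Theory.
Import numFieldNormedType.Exports.
Local Open Scope classical_set_scope.
Local Open Scope ring_scope.
Local Open Scope complex_scope.

Definition Gamma (R : realType) (z : R) : R :=
  \int[@lebesgue_measure R]_(t in `]0, +oo[) (t `^ (z - 1) * expR (- t)).

Definition caputo (R : realType) (q : R) (f : R -> R) (t : R) : R :=
  (Gamma (1 - q))^-1 *
  \int[@lebesgue_measure R]_(s in `]0, t[) ((t - s) `^ (- q) * derive1 f s).

(* The autonomous system D_t^q x = f(x). *)
Record frac_system (R : realType) (n : nat) := FracSystem {
  frac_order : R;
  rhs : 'rV[R]_n -> 'rV[R]_n }.

(* The integrals above are total; solutions are required to be regular enough
   for the Caputo derivative to be meaningful. *)
Definition is_solution (R : realType) (n : nat) (S : frac_system R n)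
    (x : R -> 'rV[R]_n) : Prop :=
  forall i : 'I_n,
    {within `[0, +oo[, continuous (fun s => x s 0 i)} /\
    forall t : R, 0 < t ->
      [/\ derivable (fun s => x s 0 i) t 1,
          (@lebesgue_measure R).-integrable `]0, t[
            (fun s => ((t - s) `^ (- frac_order S) *
                       derive1 (fun r => x r 0 i) s)%:E) &
          caputo (frac_order S) (fun s => x s 0 i) t = rhs S (x t) 0 i].

Definition equilibrium (R : realType) (n : nat) (S : frac_system R n)
    (xe : 'rV[R]_n) : Prop := rhs S xe = 0.

(* Principal argument, in ]-pi, pi], with arg 0 = 0. *)
Definition arg (R : realType) (z : R[i]) : R :=
  if z == 0 then 0 else
  let theta := acos (complex.Re z /
                     Num.sqrt (complex.Re z ^+ 2 + complex.Im z ^+ 2)) in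
  if 0 <= complex.Im z then theta else - theta.

(* With row vectors, ('J f x) j i is the partial derivative of the i-th
   component of f along the j-th coordinate, so the row eigenvectors used by
   eigenvalue and eigenspace are the column eigenvectors of (df_i/dx^j). *)
Definition jacobianC (R : realType) (n : nat) (S : frac_system R n)
    (xe : 'rV[R]_n) : 'M[R[i]]_n :=
  map_mx (real_complex R) ('J (rhs S) xe).

(* Stability is understood through Matignon's spectral test. *)
Definition asymptotically_stable (R : realType) (n : nat)
    (S : frac_system R n) (xe : 'rV[R]_n) : Prop :=
  equilibrium S xe /\
  forall l : R[i], eigenvalue (jacobianC S xe) l ->
    frac_order S * pi / 2 < `|arg l|.

Definition stable (R : realType) (n : nat)
    (S : frac_system R n) (xe : 'rV[R]_n) : Prop :=
  asymptotically_stable S xe \/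
  [/\ equilibrium S xe,
      forall l : R[i], eigenvalue (jacobianC S xe) l ->
        frac_order S * pi / 2 <= `|arg l| &
      forall l : R[i], eigenvalue (jacobianC S xe) l ->
        `|arg l| = frac_order S * pi / 2 ->
        \rank (eigenspace (jacobianC S xe) l) = 1%N].

Definition unstable (R : realType) (n : nat)
    (S : frac_system R n) (xe : 'rV[R]_n) : Prop :=
  equilibrium S xe /\ ~ stable S xe.

(* Coordinates x^1, x^2, x^3 are x 0 0, x 0 1, x 0 2. *)
Definition row3 (R : realType) (u v w : R) : 'rV[R]_3 :=
  \row_(i < 3) [:: u; v; w]`_i.

Definition chen_lee (R : realType) (a c : R) (x : 'rV[R]_3) : 'rV[R]_3 :=
  row3 (- (x 0 1 * x 0 2) + a * x 0 0)
       (x 0 0 * x 0 2)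
       (3^-1 * (x 0 0 * x 0 1) - c * x 0 2).

Definition chen_lee_control (R : realType) (a c k q : R) (xe : 'rV[R]_3) :
    frac_system R 3 :=
  FracSystem q
    (fun x => chen_lee a c x + row3 0 (k * (x 0 1 - xe 0 1)) 0).

Definition e0 (R : realType) : 'rV[R]_3 := row3 0 0 0.

Lemma chen_lee_control_e0E (R : realType) (a c k q : R) (x : 'rV[R]_3) :
  rhs (chen_lee_control a c k q (e0 R)) x =
  row3 (- (x 0 1 * x 0 2) + a * x 0 0)
       (x 0 0 * x 0 2 + k * x 0 1)
       (3^-1 * (x 0 0 * x 0 1) - c * x 0 2).
Proof.
apply/rowP => -[[|[|[|]]]] //= i_lt; rewrite !mxE /= ?addr0 ?subr0 //.
Qed.

(* Main.v *)
Require Import Defs.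
From HB Require Import structures.
From mathcomp Require Import all_boot all_order all_algebra.
From mathcomp Require Import all_classical all_reals all_analysis.
From mathcomp Require Import complex.
From mathcomp Require Import lra.
Import Order.TTheory GRing.Theory Num.Theory.
Import numFieldNormedType.Exports.
Local Open Scope ring_scope.

(** The nonlinear terms of the controlled Chen-Lee system are products of two
coordinates, both of which vanish at the origin; hence they do not contribute
to the differential there, and the Jacobian matrix at [e0] is diagonal, with
entries [a], [k] and [- c] ([jacobian_chen_lee_control]). Its complex
eigenvalues are thus these three real numbers ([eigenvalue_chen_lee_control]).

The principal argument of a real number is [pi] if the number is negative and
[0] otherwise ([arg_real]). Since [0 < q < 1], the threshold [q * pi / 2] lies
strictly between these two values, so that Matignon's test reduces to signs:
[e0] is asymptotically stable when [a], [k] and [- c] are all negative, and a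
single positive number among them makes it unstable ([unstable_eigenvalue]).
The instability claims each provide such a number: [k] if [0 < k]; [a] if
[0 < a]; and [- c] if [a] and [c] are both negative. *)

Lemma is_diff_coord (R : realType) (n : nat) (x : 'rV[R]_n) (i : 'I_n) :
  is_diff x (fun y : 'rV[R]_n => y 0 i) (fun v : 'rV[R]_n => v 0 i).
Proof.
have lin : linear (fun y : 'rV[R]_n => y 0 i : R^o) by move=> u v w; rewrite !mxE.
pose L := GRing.isLinear.Build _ _ _ _ _ lin.
pose f : {linear 'rV[R]_n -> R^o} := HB.pack (fun y : 'rV[R]_n => y 0 i : R^o) L.
apply: DiffDef; first exact: differentiable_coord.
have cf : continuous f by exact: (@coord_continuous _ 1 n 0 i).
exact: (@diff_lin _ _ _ f x cf).
Qed.

(** Coordinates are assembled along the basis of unit rows, so that the sum and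
composition rules for differentials apply. *)
Lemma is_diff_row (R : realType) (V : normedModType R) (n : nat)
    (F dF : 'I_n -> V -> R) (x : V) :
  (forall i, is_diff x (F i) (dF i)) ->
  is_diff x (fun y => \row_i F i y) (fun v => \row_i dF i v).
Proof.
move=> dFi.
have row_sumE (G : 'I_n -> V -> R) :
    (fun y => \row_i G i y) =
    \sum_(i < n) (( *:%R ^~ (delta_mx 0 i : 'rV[R]_n)) \o G i).
  apply/funext => y; rewrite fct_sumE [LHS]row_sum_delta.
  by apply: eq_bigr => i _; rewrite mxE.
rewrite !row_sumE.
elim/big_ind2 : _ => [|f df g dg hf hg|i _].
- exact: is_diff_cst.
- exact: is_diffD.
- exact: is_diff_comp.
Qed.

Lemma eigenvalue_diag (F : fieldType) (n : nat) (d : 'rV[F]_n) (l : F) :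
  eigenvalue (diag_mx d) l <-> exists i, l = d 0 i.
Proof.
rewrite eigenvalue_root_char char_poly_trig; last exact: diag_mx_is_trig.
have factorE i : (('X - (diag_mx d i i)%:P).[l] == 0) = (l == d 0 i).
  by rewrite !hornerE mxE eqxx mulr1n subr_eq0.
rewrite /root horner_prod; split.
- by case/prodf_eq0 => i _; rewrite factorE => /eqP ->; exists i.
- by case=> i li; apply/prodf_eq0; exists i; rewrite ?factorE ?li.
Qed.

Lemma arg_real (R : realType) (x : R) :
  arg (real_complex R x) = if x < 0 then pi else 0.
Proof.
rewrite /arg fmorph_eq0 /= lexx expr0n addr0 sqrtr_sqr.
case: (ltgtP x 0) => [x0|x0|_]//.
- by rewrite ltr0_norm// invrN mulrN divff ?lt_eqF// acosN1.
- by rewrite gtr0_norm// divff ?gt_eqF// acos1.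
Qed.

(** ['d f x] is chosen by a global choice operator; exhibiting a differential is
the way to compute the matrix of the map chosen. *)
Lemma jacobian_is_diff (R : realType) (m n : nat) (f : 'rV[R]_m -> 'rV[R]_n)
    (A : 'M[R]_(m, n)) (x : 'rV[R]_m) :
  is_diff x f (mulmxr A) -> 'J f x = A.
Proof.
by move=> dfx; apply/row_matrixP => i; rewrite !rowE mul_rV_lin1 diff_val.
Qed.

(** The product rule puts a factor [x i (e0 R) = 0] on each term coming from the
quadratic part, leaving only the linear part. *)
Lemma jacobian_chen_lee_control (R : realType) (a c k q : R) :
  'J (rhs (chen_lee_control a c k q (e0 R))) (e0 R) =
  diag_mx (row3 a k (- c)).
Proof.
set f := rhs _.
pose x (i : 'I_3) : 'rV[R]_3 -> R := fun y => y 0 i.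
pose F (i : 'I_3) : 'rV[R]_3 -> R :=
  [:: - (x 1 * x 2) + a *: x 0;
      x 0 * x 2 + k *: x 1;
      3^-1 *: (x 0 * x 1) - c *: x 2]`_i.
have -> : f = fun y => \row_i F i y.
  apply/funext => y; rewrite /f chen_lee_control_e0E; apply/rowP.
  by case=> [[|[|[|//]]]] lti; rewrite !mxE.
apply: jacobian_is_diff.
have x0 i : x i (e0 R) = 0 by rewrite /x mxE; case: i => [[|[|[|//]]]].
have dx i : is_diff (e0 R) (x i) (x i) := is_diff_coord _ _ _ _.
pose d : 'rV[R]_3 := row3 a k (- c).
have dF i : is_diff (e0 R) (F i) (d 0 i *: x i).
  case: i => [[|[|[|//]]]] lti; rewrite /F /d mxE /=; apply: is_diff_eq;
    rewrite !x0 !scale0r ?addr0 ?scaler0 ?oppr0 ?add0r -?scaleNr;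
    by congr (_ *: x _); apply/val_inj.
have -> : mulmxr (diag_mx d) = fun v => \row_i (d 0 i *: x i) v.
  by apply/funext => v; apply/rowP => i; rewrite /= mul_mx_diag !mxE mulrC.
exact: is_diff_row.
Qed.

Lemma eigenvalue_chen_lee_control (R : realType) (a c k q : R) (l : R[i]) :
  let S := chen_lee_control a c k q (e0 R) in
  eigenvalue (jacobianC S (e0 R)) l <->
  l \in [:: real_complex R a; real_complex R k; real_complex R (- c)].
Proof.
rewrite /jacobianC jacobian_chen_lee_control map_diag_mx !inE.
split=> [/eigenvalue_diag[i ->]|/or3P lE].
  by rewrite !mxE; case: i => [[|[|[|//]]]] lti /=; rewrite eqxx ?orbT.
apply/eigenvalue_diag; case: lE => /eqP ->.
- by exists 0; rewrite !mxE.
- by exists 1; rewrite !mxE.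
- by exists 2; rewrite !mxE.
Qed.

Lemma equilibrium_chen_lee_control (R : realType) (a c k q : R) :
  equilibrium (chen_lee_control a c k q (e0 R)) (e0 R).
Proof.
rewrite /equilibrium chen_lee_control_e0E; apply/rowP.
by case=> [[|[|[|//]]]] lti; rewrite !mxE /= ?(mulr0, oppr0, addr0).
Qed.

(** A nonnegative real eigenvalue has argument [0], below the positive threshold;
this excludes both alternatives in the definition of stability. *)
Lemma unstable_eigenvalue (R : realType) (n : nat) (S : frac_system R n)
    (xe : 'rV[R]_n) (x : R) :
  0 < frac_order S -> equilibrium S xe ->
  0 <= x -> eigenvalue (jacobianC S xe) (real_complex R x) -> unstable S xe.
Proof.
move=> q_gt0 eqxe x_ge0 eig; split=> //.
have th_gt0 : 0 < frac_order S * pi / 2.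
  by rewrite divr_gt0 ?mulr_gt0 ?pi_gt0.
have arg0 : `|arg (real_complex R x)| = 0 by rewrite arg_real ltNge x_ge0 normr0.
case=> [[_ /(_ _ eig)]|[_ /(_ _ eig) + _]]; rewrite arg0.
- by rewrite ltNge ltW.
- by rewrite leNgt th_gt0.
Qed.

Theorem theorem3 (R : realType) (a c k q : R)
    (a_neq0 : a != 0) (c_neq0 : c != 0) (k_neq0 : k != 0)
    (q_gt0 : 0 < q) (q_lt1 : q < 1) :
  let S := chen_lee_control a c k q (e0 R) in
  (k < 0 ->
     (a < 0 -> 0 < c -> asymptotically_stable S (e0 R)) /\
     (0 < a * c \/ (0 < a /\ c < 0) -> unstable S (e0 R))) /\
  (0 < k -> unstable S (e0 R)).
Proof.
move=> S.
have unstableS x : 0 < x -> x \in [:: a; k; - c] -> unstable S (e0 R).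
  move=> x_gt0 xin; apply: (@unstable_eigenvalue _ _ _ _ x) => //.
  - exact: equilibrium_chen_lee_control.
  - exact: ltW.
  - apply/eigenvalue_chen_lee_control.
    exact: (map_f (real_complex R) xin).
split=> [k_lt0|k_gt0]; last first.
  by apply: (unstableS k); rewrite // !inE eqxx orbT.
split=> [a_lt0 c_gt0|signs].
  split=> [|l /eigenvalue_chen_lee_control].
    exact: equilibrium_chen_lee_control.
  move/(mapP (s := [:: a; k; - c])) => [x xin ->].
  have x_lt0 : x < 0.
    by move: xin; rewrite !inE => /or3P[]/eqP-> //; rewrite oppr_lt0.
  (* [q * pi / 2 < pi], since [q < 1] *)
  rewrite arg_real x_lt0 gtr0_norm ?pi_gt0//=.
  by have := pi_gt0 R; nra.
case: (ltgtP a 0) a_neq0 => // [a_lt0|a_gt0] _; last first.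
  by apply: (unstableS a); rewrite // !inE eqxx.
apply: (unstableS (- c)); last by rewrite !inE eqxx !orbT.
case: signs => [|[a_gt0 _]]; last by have := lt_trans a_lt0 a_gt0; rewrite ltxx.
by rewrite nmulr_rgt0// oppr_gt0.
Qed.
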